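(* If $\varphi:\mathcal A\to M_n(\mathbb C)$ is a linear isometry (i.e. $\varphi$ is linear and $\|\varphi(A)\|=\|A\|$ for all $A\in\mathcal A$), then $\varphi$ preserves singular values: for every $A\in\mathcal A$, the matrices $A$ and $\varphi(A)$ have the same singular values (counted with multiplicity), equivalently $\det(\lambda I-A^*A)=\det(\lambda I-\varphi(A)^*\varphi(A))$ as polynomials in $\lambda$.
   Context: $S$ denotes the $n\times n$ nilpotent Jordan block with ones on the superdiagonal and zeros elsewhere. $\mathcal A=\{f(S): f\text{ a complex polynomial}\}$ is the algebra of $n\times n$ upper-triangular Toeplitz matrices. $\|\cdot\|$ is the operator norm on $M_n(\mathbb C)$ induced by the Euclidean norm on $\mathbb C^n$. *)

(* Defs.v *)
(* Complex numbers are modelled by an arbitrary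
   numeric algebraically closed field C (e.g. algC). *)
From HB Require Import structures.
From mathcomp Require Import all_boot all_order all_algebra.
Set Implicit Arguments. Unset Strict Implicit. Unset Printing Implicit Defensive.
Import Order.TTheory GRing.Theory Num.Theory.
Local Open Scope ring_scope.

(* Matrices are of size n.+1 (i.e. dimension >= 1, needed for the ring
   structure used by horner_mx).
   The (n+1) x (n+1) nilpotent Jordan block: ones on the superdiagonal. *)
Definition Sjordan (C : numClosedFieldType) (n : nat) : 'M[C]_n.+1 :=
  \matrix_(i < n.+1, j < n.+1) (((i : nat).+1 == j)%N)%:R.

(* The algebra A = { f(S) : f a polynomial } of upper-triangular Toeplitz matrices. *)
Definition in_toeplitz (C : numClosedFieldType) (n : nat) (A : 'M[C]_n.+1) : Prop :=
  exists p : {poly C}, A = horner_mx (Sjordan C n) p.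

Definition adjmx (C : numClosedFieldType) (m n : nat) (A : 'M[C]_(m, n)) : 'M[C]_(n, m) :=
  (map_mx Num.conj A)^T.

Definition vnorm (C : numClosedFieldType) (n : nat) (v : 'cV[C]_n.+1) : C :=
  sqrtC (\sum_(i < n.+1) `|v i 0| ^+ 2).

(* s is the operator norm of A (induced by the Euclidean norm):
   the least upper bound of ||A v|| over ||v|| <= 1, written as the
   least s >= 0 with ||A v|| <= s ||v|| for all v. *)
Definition is_opnorm (C : numClosedFieldType) (n : nat) (A : 'M[C]_n.+1) (s : C) : Prop :=
  [/\ 0 <= s,
      (forall v : 'cV[C]_n.+1, vnorm (A *m v) <= s * vnorm v) &
      (forall t : C, (forall v : 'cV[C]_n.+1, vnorm (A *m v) <= t * vnorm v) -> s <= t)].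

Definition linear_on_toeplitz (C : numClosedFieldType) (n : nat)
    (phi : 'M[C]_n.+1 -> 'M[C]_n.+1) : Prop :=
  forall (a : C) (A B : 'M[C]_n.+1), in_toeplitz A -> in_toeplitz B ->
    phi (a *: A + B) = a *: phi A + phi B.

Definition isometry_on_toeplitz (C : numClosedFieldType) (n : nat)
    (phi : 'M[C]_n.+1 -> 'M[C]_n.+1) : Prop :=
  forall A : 'M[C]_n.+1, in_toeplitz A ->
    forall s : C, is_opnorm A s <-> is_opnorm (phi A) s.

(* Main.v *)
(* For A = f(S), the largest root of P_A = det(x - A^* A) is ||A||^2, so P_A and
   Q_A = det(x - phi(A)^* phi(A)) always have a common root.  Let A vary along a
   curve A(t), polynomial in the real parameter t: P and Q become monic
   polynomials over C[t] whose resultant vanishes at all real t, hence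
   identically.  If P is irreducible over C(t), then P = Q.  Irreducibility is
   obtained at the non-real point t = i, where A(t)^* continues to the unrelated
   matrix A(-i)^*: for A(i) = 1 and A(-i) = 1 + S, the product A(-i)^* A(i) is
   1 + S^T, so P(x, i) = (x - 1)^n, and P(1, t) has a simple zero at t = i as soon
   as the corner entry of A'(i) is nonzero.  Thus P(x + 1, t) is Eisenstein at
   t = i.  A cubic curve with these properties passes through any given A. *)
Require Import Defs.
From HB Require Import structures.
From mathcomp Require Import all_boot all_order all_algebra ring.
Set Implicit Arguments.
Unset Strict Implicit.
Unset Printing Implicit Defensive.
Import Order.TTheory GRing.Theory Num.Theory.
Local Open Scope ring_scope.

(** * Weighted valuations and an Eisenstein criterion over C[t] *)

Lemma size_monicB (R : nzRingType) (p q : {poly R}) (n : nat) :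
  p \is monic -> q \is monic -> size p = n.+1 -> size q = n.+1 ->
  (size (p - q)%R <= n)%N.
Proof.
move=> pm qm sp sq; apply/leq_sizeP => k.
rewrite leq_eqVlt coefB => /predU1P[<-|nk].
  have := monicP pm; have := monicP qm.
  by rewrite !lead_coefE sp sq /= => -> ->; rewrite subrr.
by rewrite !nth_default ?sp ?sq // subrr.
Qed.

Lemma poly_lowest_split (R : nzRingType) (p : {poly R}) :
  p != 0 -> exists d (q : {poly R}), q`_0 != 0 /\ p = q * 'X^d.
Proof.
move=> p0; have [d [q]] := multiplicity_XsubC p 0.
rewrite p0 /= subr0 /root horner_coef0 => q0 ->.
by exists d, q.
Qed.

Lemma eq_mul_polyXn (R : nzRingType) (p q : {poly R}) a b :
  p`_0 != 0 -> q`_0 != 0 -> p * 'X^a = q * 'X^b -> p = q.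
Proof.
wlog le_ab : p q a b / (a <= b)%N => [hw p0 q0 e|p0 q0].
  case/orP: (leq_total a b) => le; first exact: hw p0 q0 e.
  by symmetry; apply: hw q0 p0 (esym e).
rewrite -(subnK le_ab) exprD mulrA.
move=> e; have /polyP pq : p = q * 'X^(b - a).
  apply/polyP=> i; have /polyP/(_ (i + a)%N) := e.
  by rewrite !coefMXn ltnNge leq_addl /= addnK.
move: (pq 0%N); rewrite coefMXn.
case: (posnP (b - a)) => [ab0 _|pos e0]; last by rewrite e0 eqxx in p0.
by apply/polyP => i; rewrite pq ab0 mulr1.
Qed.

(* f(t, mu) |-> f(s^n, s mu), as a polynomial in s with coefficients in F[mu]. *)
Definition weight_subst (F : fieldType) (n : nat) (f : {poly {poly F}}) :
    {poly {poly F}} :=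
  (map_poly (comp_poly 'X^n \o map_poly polyC) f).['X * ('X)%:P].

Lemma weight_substD (F : fieldType) (n : nat) :
  {morph @weight_subst F n : f g / f + g}.
Proof. by move=> f g; rewrite /weight_subst rmorphD hornerD. Qed.

Lemma weight_substM (F : fieldType) (n : nat) :
  {morph @weight_subst F n : f g / f * g}.
Proof. by move=> f g; rewrite /weight_subst rmorphM hornerM. Qed.

Lemma weight_substXn (F : fieldType) (n k : nat) :
  weight_subst n ('X^k : {poly {poly F}}) = ('X^k)%:P * 'X^k.
Proof.
by rewrite /weight_subst map_polyXn hornerXn exprMn mulrC -polyC_exp.
Qed.

(** A monomial t^i mu^j has weight i n + j. For j below n, Euclidean division by n recovers i and j
    from the weight, so distinct monomials land on distinct powers of s and nothing cancels. *)
Lemma coef_weight_subst (F : fieldType) (n : nat) (f : {poly {poly F}}) k :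
  (0 < n)%N -> (size f <= n)%N ->
  (weight_subst n f)`_k = (f`_(k %% n))`_(k %/ n) *: 'X^(k %% n).
Proof.
move=> n0 sf.
rewrite /weight_subst (horner_coef_wide _ (leq_trans (size_poly _ _) sf)).
rewrite coef_sum (bigD1 (Ordinal (ltn_pmod k n0))) //.
have term j : ((map_poly (comp_poly 'X^n \o map_poly polyC) f)`_j
   * ('X * ('X)%:P) ^+ j)`_k =
   if (j <= k)%N then if (n %| k - j)%N then (f`_j)`_((k - j) %/ n) *: 'X^j else 0
   else 0 :> {poly F}.
  rewrite coef_map exprMn mulrA mulrAC -polyC_exp coefMXn ltnNge.
  case: leqP => //= jk; rewrite coefMC coef_comp_poly_Xn //.
  case: ifP => _; last by rewrite mul0r.
  by rewrite coef_map /= mul_polyC.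
have kE : (k - k %% n = k %/ n * n)%N by rewrite {1}(divn_eq k n) addnK.
rewrite big1 => [|j]; first by rewrite Monoid.mulm1 term /= leq_mod kE dvdn_mull // mulnK.
rewrite -val_eqE /= => jk; rewrite term; case: leqP => // le_jk.
case: ifP => // d; case/eqP: jk.
by rewrite -(subnK le_jk) -modnDml (eqP d) add0n modn_small.
Qed.

Lemma weight_subst_neq0 (F : fieldType) (n : nat) (f : {poly {poly F}}) :
  (0 < n)%N -> (size f <= n)%N -> f != 0 -> weight_subst n f != 0.
Proof.
move=> n0 sf; apply: contra_neq => e0; apply/polyP => j; apply/polyP => i.
rewrite coef0; case: (ltnP j n) => jn; last first.
  by rewrite (nth_default _ (leq_trans sf jn)) coef0.
have := congr1 (fun p : {poly {poly F}} => p`_(i * n + j)`_j) e0.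
rewrite !coef0 coef_weight_subst // modnMDl modn_small // divnMDl // divn_small //.
by rewrite addn0 coefZ coefXn eqxx mulr1.
Qed.

(* The valuation with weights v(t) = n, v(mu) = 1: the lowest form of a
   polynomial of mu-degree < n is a single monomial, whereas that of [p] is
   [mu^n + u t], which divides no monomial. *)
Lemma eisenstein_mul_neq (C : numClosedFieldType) (n : nat)
    (p v r w : {poly {poly C}}) :
  (0 < n)%N -> p \is monic -> size p = n.+1 ->
  (forall j, (j < n)%N -> p`_j`_0 = 0) -> p`_0`_1 != 0 ->
  (size v <= n)%N -> (size r <= n)%N -> v != 0 -> r != 0 -> v * r != w * p.
Proof.
move=> n0 pm sp pj p01 sv sr v0 r0; apply/eqP => e.
set sg := @weight_subst C n.
have mono (f : {poly {poly C}}) : (size f <= n)%N -> f != 0 ->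
    exists a (c : C) j (g : {poly {poly C}}),
      [/\ c != 0, g`_0 = c *: 'X^j & sg f = g * 'X^a].
  move=> sf f0; have [a [g [g0 eg]]] := poly_lowest_split (weight_subst_neq0 n0 sf f0).
  have eg0 : g`_0 = f`_(a %% n)`_(a %/ n) *: 'X^(a %% n).
    by rewrite -coef_weight_subst // eg coefMXn ltnn subnn.
  exists a, f`_(a %% n)`_(a %/ n), (a %% n)%N, g; split=> //.
  by apply: contraNneq g0 => c0; rewrite eg0 c0 scale0r.
have [a [c [i [g [c0 g0 eg]]]]] := mono v sv v0.
have [b [d [j [h [d0 h0 eh]]]]] := mono r sr r0.
pose p' := p - 'X^n.
have sp' : (size p' <= n)%N by rewrite size_monicB ?monicXn ?size_polyXn.
have ep : p = p' + 'X^n by rewrite subrK.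
have p'c k : (k < n)%N -> p'`_k = p`_k.
  by move=> kn; rewrite coefB coefXn ltn_eqF // subr0.
pose u := p`_0`_1.
(* Monomials of weight below n are the mu^k with k below n, absent from [p] by [pj]; those of weight
   n are the leading mu^n and u t. *)
have [q [q0 eq]] : exists q : {poly {poly C}}, q`_0 = 'X^n + u%:P /\ sg p = q * 'X^n.
  exists (drop_poly n (sg p')+ ('X^n)%:P); split.
    rewrite coefD coefC eqxx coef_drop_poly add0n coef_weight_subst // modnn divnn n0.
    by rewrite p'c // expr0 alg_polyC addrC.
  rewrite mulrDl -(weight_substXn C n n) -/sg {1}ep /sg weight_substD -/sg; congr (_ + _).
  rewrite -{1}(poly_take_drop n (sg p')) [take_poly _ _](_ : _ = 0) ?add0r //.
  apply/polyP => k; rewrite coef_take_poly coef0; case: ifP => // kn.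
  by rewrite coef_weight_subst // modn_small // divn_small // p'c // pj // scale0r.
have w0 : w != 0.
  apply: contraNneq (mulf_neq0 v0 r0) => w0; by rewrite e w0 mul0r.
have sw : sg w != 0.
  apply/eqP => w00; have := weight_substM n w p; rewrite -e weight_substM.
  rewrite -!/sg w00 mul0r => /eqP; rewrite mulf_eq0.
  by rewrite !(negPf (weight_subst_neq0 n0 _ _)).
have [l [k [k0 ek]]] := poly_lowest_split sw.
(* This value of mu annihilates mu^n + u, whereas a nonzero monomial in mu survives there because u
   is nonzero. *)
have root_n : (('X^n + u%:P).[n.-root (- u)] = 0 :> C).
  by rewrite hornerD hornerXn hornerC rootCK // addNr.
have q00 : q`_0 != 0.
  rewrite q0; apply/eqP => /(congr1 (fun f : {poly C} => f`_n)).
  by rewrite coefD coefXn eqxx coefC gtn_eqF // addr0 coef0 => /eqP; rewrite oner_eq0.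
have /(congr1 sg) := e; rewrite /sg !weight_substM -/sg eg eh ek eq.
rewrite mulrACA -exprD mulrACA -exprD => ee.
have gh0 : (g * h)`_0 = (c * d) *: 'X^(i + j).
  by rewrite coefM big_ord1 subnn g0 h0 -scalerAr -scalerAl scalerA exprD mulrC.
have nz0 (x : C) m : x != 0 -> x *: 'X^m != 0 :> {poly C}.
  by move=> x0; rewrite scaler_eq0 negb_or x0 expf_neq0 // polyX_eq0.
have kq0 : (k * q)`_0 = k`_0 * ('X^n + u%:P).
  by rewrite coefM big_ord1 subnn q0.
have := eq_mul_polyXn _ _ ee.
rewrite gh0 kq0 nz0 ?mulf_neq0 // -?q0 // => /(_ isT isT).
move/(congr1 (fun f : {poly {poly C}} => (f`_0).[n.-root (- u)])).
rewrite gh0 kq0 hornerM root_n mulr0 hornerZ hornerXn => /eqP.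
by rewrite !mulf_eq0 (negPf c0) (negPf d0) expf_eq0 rootC_eq0 // oppr_eq0 (negPf p01)
  andbF.
Qed.

(** A zero resultant gives a nonconstant gcd g, with a p = f g and b q = h g for f and h of degree
    below n. Then b f (q - p) = (a h - b f) p; if q differed from p, both factors on the left would
    be nonzero of degree below n, against [eisenstein_mul_neq]. *)
Lemma eisenstein_resultant_eq (C : numClosedFieldType) (n : nat)
    (p q : {poly {poly C}}) :
  (0 < n)%N -> p \is monic -> size p = n.+1 ->
  (forall j, (j < n)%N -> p`_j`_0 = 0) -> p`_0`_1 != 0 ->
  q \is monic -> size q = n.+1 -> resultant p q = 0 -> p = q.
Proof.
move=> n0 pm sp pj p01 qm sq /eqP; rewrite resultant_eq0 => sg.
have p0 : p != 0 by exact: monic_neq0.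
have g0 : gcdp p q != 0 by rewrite -size_poly_gt0 ltnW.
have /Pdiv.Idomain.dvdpP [[a f] /= a0 ef] := dvdp_gcdl p q.
have /Pdiv.Idomain.dvdpP [[b h] /= b0 eh] := dvdp_gcdr p q.
have q0 : q != 0 by exact: monic_neq0.
have cofactor_small k c r : r \is monic -> size r = n.+1 -> c != 0 ->
    c *: r = k * gcdp p q -> k != 0 /\ (size k <= n)%N.
  move=> rm sr c0 e; have k0 : k != 0.
    apply: contraNneq (monic_neq0 rm) => k0.
    by move/eqP: e; rewrite k0 mul0r scale_poly_eq0 (negPf c0).
  split=> //; have := congr1 (fun r : {poly {poly C}} => size r) e.
  rewrite size_scale // sr size_mul // => se.
  have : (size k + 1 <= n.+1)%N by rewrite se addn1 -ltnS prednK ?addn_gt0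
    ?size_poly_gt0 ?k0 // -addn2 leq_add2l.
  by rewrite addn1.
have [f0 sf] := cofactor_small f a p pm sp a0 ef.
have [h0 sh] := cofactor_small h b q qm sq b0 eh.
apply/eqP; rewrite eq_sym -subr_eq0; apply: contraT => r0.
have sr : (size (q - p)%R <= n)%N by exact: size_monicB.
have := @eisenstein_mul_neq _ _ p (b *: f) (q - p) (a *: h - b *: f) n0 pm sp pj p01.
rewrite size_scale // sf sr scale_poly_eq0 negb_or b0 f0 r0 => /(_ isT isT isT isT).
rewrite mulrBr mulrBl (inj_eq (addIr _)) -!scalerAl => /eqP[].
apply: (mulIf g0); rewrite -!scalerAl mulrAC -ef [h * p]mulrC -mulrA -eh.
by rewrite -scalerAl -scalerAr !scalerA mulrC.
Qed.

(** * The operator norm and the Gram matrix *)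

Lemma adjmxM (C : numClosedFieldType) (m n p : nat) (A : 'M[C]_(m, n)) (B : 'M_(n, p)) :
  adjmx (A *m B) = adjmx B *m adjmx A.
Proof. by rewrite /adjmx map_mxM trmx_mul. Qed.

Lemma adjmxK (C : numClosedFieldType) (m n : nat) (A : 'M[C]_(m, n)) :
  adjmx (adjmx A) = A.
Proof. by apply/matrixP => i j; rewrite !mxE conjCK. Qed.

Lemma vnorm_sqr (C : numClosedFieldType) (n : nat) (v : 'cV[C]_n.+1) :
  vnorm v ^+ 2 = \sum_i `|v i 0| ^+ 2.
Proof. by rewrite /vnorm sqrtCK. Qed.

Lemma vnorm_ge0 (C : numClosedFieldType) (n : nat) (v : 'cV[C]_n.+1) : 0 <= vnorm v.
Proof. by rewrite sqrtC_ge0 sumr_ge0 // => i _; rewrite exprn_ge0. Qed.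

Lemma form_diag_mx (C : numClosedFieldType) (n : nat) (d : 'rV[C]_n) (w : 'cV[C]_n) :
  (adjmx w *m diag_mx d *m w) 0 0 = \sum_i d 0 i * `|w i 0| ^+ 2.
Proof.
rewrite mxE; apply: eq_bigr => i _; rewrite mul_mx_diag !mxE.
by rewrite mulrAC -normCKC mulrC.
Qed.

Lemma vnorm_sqr_mul (C : numClosedFieldType) (n : nat) (v : 'cV[C]_n.+1) :
  vnorm v ^+ 2 = (adjmx v *m v) 0 0.
Proof.
rewrite vnorm_sqr -[adjmx v]mulmx1 -diag_const_mx form_diag_mx.
by apply: eq_bigr => i _; rewrite mxE mul1r.
Qed.

Lemma gram_spectral (C : numClosedFieldType) (n : nat) (A : 'M[C]_n.+1) :
  exists (P : 'M[C]_n.+1) (d : 'rV[C]_n.+1),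
    [/\ adjmx P *m P = 1%:M, P *m adjmx P = 1%:M &
        adjmx A *m A = adjmx P *m diag_mx d *m P].
Proof.
set H := adjmx A *m A.
have nH : H \is normalmx.
  apply: hermitian_normalmx; apply/is_hermitianmxP; rewrite expr0 scale1r.
  by rewrite -map_trmx -[RHS]/(adjmx H) adjmxM adjmxK.
have /orthomx_spectralP eH := nH.
have uP := spectral_unitarymx H; have iP := invmx_unitary uP.
exists (spectralmx H), (spectral_diag H).
have -> : adjmx (spectralmx H) = invmx (spectralmx H).
  by rewrite iP /adjmx map_trmx.
by rewrite mulVmx ?mulmxV ?spectral_unit.
Qed.

(** In an orthonormal eigenbasis of A^* A, the square of ||A v|| is the sum of the squared
    coordinates weighted by the eigenvalues. The norm is thus attained at an eigenvector of the
    largest eigenvalue, and exists in [C] without any completeness. *)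
Lemma opnorm_exists (C : numClosedFieldType) (n : nat) (A : 'M[C]_n.+1) :
  exists2 s : C, is_opnorm A s & root (char_poly (adjmx A *m A)) (s ^+ 2).
Proof.
have [P [d [PP1 PP2 eA]]] := gram_spectral A.
have normP (v : 'cV_n.+1) : vnorm (P *m v) ^+ 2 = vnorm v ^+ 2.
  by rewrite !vnorm_sqr_mul adjmxM mulmxA -(mulmxA _ _ P) PP1 mulmx1.
have normA (v : 'cV_n.+1) :
    vnorm (A *m v) ^+ 2 = \sum_i d 0 i * `|(P *m v) i 0| ^+ 2.
  rewrite vnorm_sqr_mul -form_diag_mx !adjmxM mulmxA -(mulmxA _ _ A) eA.
  by rewrite !mulmxA.
pose e i : 'cV[C]_n.+1 := adjmx P *m delta_mx i 0.
have Pe i : P *m e i = delta_mx i 0 by rewrite mulmxA PP2 mul1mx.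
have sum_delta (F : 'I_n.+1 -> C) i :
    \sum_j F j * `|(delta_mx i 0 : 'cV[C]_n.+1) j 0| ^+ 2 = F i.
  rewrite (bigD1 i) //= big1 => [|j ji]; rewrite !mxE ?eqxx.
    by rewrite normr1 expr1n mulr1 addr0.
  by rewrite (negPf ji) normr0 expr0n mulr0.
have Ae i : vnorm (A *m e i) ^+ 2 = d 0 i by rewrite normA Pe sum_delta.
have e1 i : vnorm (e i) = 1.
  apply/eqP; rewrite -(eqrXn2 (n := 2)) ?vnorm_ge0 // -normP Pe expr1n.
  rewrite vnorm_sqr -(sum_delta (fun=> 1) i).
  by apply/eqP/eq_bigr => j _; rewrite mul1r.
have d0 i : 0 <= d 0 i by rewrite -Ae exprn_ge0 ?vnorm_ge0.
have [i [_ imax]] : exists i, True /\ forall j, d 0 j <= d 0 i.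
  have dreal : {in xpredT, forall i, d 0 i \is Num.real} by move=> j _; rewrite ger0_real.
  by have [i _ h] := real_arg_maxP (i0 := ord0) isT dreal; exists i; split=> // j;
    apply: h.
exists (sqrtC (d 0 i)); rewrite ?sqrtCK.
  split; first by rewrite sqrtC_ge0.
    move=> v; rewrite -(ler_pXn2r (n := 2)) ?nnegrE ?mulr_ge0 ?vnorm_ge0 ?sqrtC_ge0 //.
    rewrite exprMn (sqrtCK (d 0 i)) normA -normP vnorm_sqr mulr_sumr.
    by apply: ler_sum => j _; rewrite ler_wpM2r // exprn_ge0.
  by move=> t /(_ (e i)); rewrite e1 mulr1 -Ae sqrCK ?vnorm_ge0.
(* Eigenvectors are row vectors here, and row i of [P] is one for [d 0 i]. *)
rewrite -eigenvalue_root_char; apply/eigenvalueP; exists (delta_mx 0 i *m P).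
  rewrite eA !mulmxA -(mulmxA _ P) PP2 mulmx1 -(rowE i (diag_mx d)) row_diag_mx.
  by rewrite -scalemxAl.
apply: contraTneq (oner_neq0 C) => /(congr1 (fun u => (u *m adjmx P) 0 i)).
by rewrite -mulmxA PP2 mulmx1 mul0mx !mxE !eqxx => u0; apply/negPn/eqP.
Qed.

Lemma is_opnorm_inj (C : numClosedFieldType) (n : nat) (A : 'M[C]_n.+1) (s t : C) :
  is_opnorm A s -> is_opnorm A t -> s = t.
Proof.
move=> [s0 sA smin] [t0 tA tmin]; apply/eqP; rewrite eq_le.
by rewrite smin // tmin.
Qed.

(** This is all that the isometry contributes: the common squared norm is an eigenvalue of both Gram
    matrices. *)
Lemma same_opnorm_common_root (C : numClosedFieldType) (n : nat) (A B : 'M[C]_n.+1) :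
  (forall s, is_opnorm A s <-> is_opnorm B s) ->
  exists x, root (char_poly (adjmx A *m A)) x /\ root (char_poly (adjmx B *m B)) x.
Proof.
move=> AB; have [s sA rA] := opnorm_exists A; have [t tB rB] := opnorm_exists B.
exists (s ^+ 2); split=> //.
by rewrite (is_opnorm_inj ((AB s).1 sA) tB).
Qed.

(** * Translation of characteristic polynomials *)

(** Subtracting the identity from the Gram matrices moves the root 1 at t = i to 0, where the
    Eisenstein conditions are read off. *)
Lemma char_poly_addC (R : comNzRingType) (n : nat) (M : 'M[R]_n) (a : R) :
  char_poly (M + a%:M) = char_poly M \Po ('X - a%:P).
Proof.
rewrite /char_poly /char_poly_mx -[RHS]/(comp_poly _ _) -det_map_mx; congr (\det _).
apply/matrixP => i j; rewrite !mxE rmorphB rmorphMn /= comp_polyX comp_polyC.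
by rewrite polyCD polyCMn mulrnBl opprD addrA addrAC.
Qed.

Lemma char_poly_addC_inj (R : comNzRingType) (n : nat) (M N : 'M[R]_n) (a : R) :
  char_poly (M + a%:M) = char_poly (N + a%:M) -> char_poly M = char_poly N.
Proof.
move=> e; have := congr1 (comp_poly ('X - (- a)%:P)) e.
by rewrite -!char_poly_addC -!addrA -raddfD /= subrr raddf0 !addr0.
Qed.

Lemma root_char_poly_addC (R : comNzRingType) (n : nat) (M : 'M[R]_n) (a x : R) :
  root (char_poly M) x -> root (char_poly (M + a%:M)) (x + a).
Proof.
move=> rx; rewrite char_poly_addC /root horner_comp hornerD hornerX hornerN hornerC.
by rewrite addrK.
Qed.

(** * Toeplitz matrices *)

Lemma SjordanE (C : numClosedFieldType) (n k : nat) (i j : 'I_n.+1) :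
  (Sjordan C n ^+ k) i j = (i + k == j)%N%:R.
Proof.
elim: k i j => [|k IHk] i j; first by rewrite expr0 mxE addn0.
rewrite exprS -mulmxE mxE.
case: (ltnP i.+1 n.+1) => [lt_in|le_ni]; last first.
  rewrite big1 => [|l _]; first by rewrite gtn_eqF // (leq_trans (ltn_ord j)) //
    (leq_trans le_ni) // -addSnnS leq_addr.
  by rewrite mxE gtn_eqF ?mul0r // (leq_trans (ltn_ord l)).
rewrite (bigD1 (Ordinal lt_in)) //= big1 => [|l].
  by rewrite mxE eqxx mul1r IHk addr0 addSnnS.
by rewrite -val_eqE /= eq_sym => li; rewrite mxE (negPf li) mul0r.
Qed.

Lemma in_toeplitzZD (C : numClosedFieldType) (n : nat) (a : C) (A B : 'M[C]_n.+1) :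
  in_toeplitz A -> in_toeplitz B -> in_toeplitz (a *: A + B).
Proof.
move=> [p ->] [q ->]; exists (a *: p + q).
by rewrite linearP.
Qed.

Lemma in_toeplitz0 (C : numClosedFieldType) (n : nat) : in_toeplitz (0 : 'M[C]_n.+1).
Proof. by exists 0; rewrite rmorph0. Qed.

Lemma in_toeplitzXn (C : numClosedFieldType) (n k : nat) : in_toeplitz (Sjordan C n ^+ k).
Proof. by exists 'X^k; rewrite rmorphXn /= horner_mx_X. Qed.

Lemma toeplitz_col0 (C : numClosedFieldType) (n : nat) (A : 'M[C]_n.+1) (i : 'I_n.+1) :
  in_toeplitz A -> i != 0 -> A i 0 = 0.
Proof.
move=> [p ->] i0; elim/poly_ind: p => [|p c _]; first by rewrite rmorph0 mxE.
rewrite rmorphD rmorphM /= horner_mx_X horner_mx_C !mxE (negPf i0) mulr0n addr0.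
by rewrite big1 // => k _; rewrite [X in _ * X]mxE mulr0.
Qed.

Lemma linear_on_toeplitz_sum (C : numClosedFieldType) (n : nat)
    (phi : 'M[C]_n.+1 -> 'M[C]_n.+1) (m : nat) (a : nat -> C) (X : nat -> 'M[C]_n.+1) :
  linear_on_toeplitz phi -> (forall k, in_toeplitz (X k)) ->
  in_toeplitz (\sum_(k < m) a k *: X k) /\
  phi (\sum_(k < m) a k *: X k) = \sum_(k < m) a k *: phi (X k).
Proof.
move=> lin TX; elim: m => [|m [IHT IH]].
  rewrite !big_ord0; split; first exact: in_toeplitz0.
  have := lin 1 0 0 (in_toeplitz0 C n) (in_toeplitz0 C n).
  by rewrite !scale1r addr0 => /eqP; rewrite -subr_eq0 opprD addrA subrr add0r oppr_eq0
    => /eqP.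
rewrite !big_ord_recr /= ![_ + _ *: _]addrC; split; first exact: in_toeplitzZD.
by rewrite lin // IH.
Qed.

(** * Matrix curves and their Gram matrices *)

(* [\sum_k t^k X_k], written in the local parameter ['X] = t - i at t = i. *)
Definition mxcurve (C : numClosedFieldType) (n m : nat) (X : nat -> 'M[C]_n.+1) :
    'M[{poly C}]_n.+1 :=
  \matrix_(i, j) \sum_(k < m) X k i j *: ('X + 'i%:P) ^+ k.

Lemma mxcurve_eval (C : numClosedFieldType) (n m : nat) (X : nat -> 'M[C]_n.+1) (t : C) :
  map_mx (horner_eval (t - 'i)) (mxcurve m X) = \sum_(k < m) t ^+ k *: X k.
Proof.
apply/matrixP => i j; rewrite !mxE /horner_eval horner_sum summxE.
apply: eq_bigr => k _; rewrite hornerZ horner_exp hornerD hornerX hornerC subrK.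
by rewrite mxE mulrC.
Qed.

(** The curve of adjoint coefficients is the continued adjoint: at real t it is A(t)^*, while at t =
    i it is A(-i)^*. *)
Lemma adjmx_sum (C : numClosedFieldType) (n m : nat) (X : nat -> 'M[C]_n.+1) (t : C) :
  \sum_(k < m) (Num.conj t) ^+ k *: adjmx (X k) = adjmx (\sum_(k < m) t ^+ k *: X k).
Proof.
apply/matrixP => i j; rewrite !mxE !summxE rmorph_sum.
by apply: eq_bigr => k _; rewrite !mxE rmorphM rmorphXn.
Qed.

(* [A(t)^* A(t) - 1] with the adjoint continued analytically from real t. *)
Definition gram_curve (C : numClosedFieldType) (n m : nat) (X : nat -> 'M[C]_n.+1) :
    'M[{poly C}]_n.+1 :=
  mxcurve m (fun k => adjmx (X k)) *m mxcurve m X + (-1)%:M.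

Lemma gram_curve_eval (C : numClosedFieldType) (n m : nat) (X : nat -> 'M[C]_n.+1)
    (t : C) :
  map_mx (horner_eval (t - 'i)) (gram_curve m X) =
  adjmx (\sum_(k < m) (Num.conj t) ^+ k *: X k) *m (\sum_(k < m) t ^+ k *: X k) + (-1)%:M.
Proof.
rewrite map_mxD map_mxM !mxcurve_eval map_scalar_mx /= /horner_eval hornerN hornerC.
by rewrite -adjmx_sum conjCK.
Qed.

(** * The Eisenstein property and specialization at real parameters *)

(** At parameter 0 the matrix is the nilpotent lower shift, whose characteristic polynomial is a
    pure power. Its row 0 vanishes there, so the linear term of the determinant pairs the linear
    terms of row 0 with the constant cofactors, of which only the last is nonzero. *)
Lemma eisenstein_char_poly (F : numClosedFieldType) (n : nat) (M : 'M[{poly F}]_n.+1) :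
  (forall i j, (M i j)`_0 = (j.+1 == i)%N%:R) -> (M 0 ord_max)`_1 != 0 ->
  (forall k, (k < n.+1)%N -> (char_poly M)`_k`_0 = 0) /\ (char_poly M)`_0`_1 != 0.
Proof.
move=> M0 M1; pose N : 'M[F]_n.+1 := \matrix_(i, j) (j.+1 == i)%N%:R.
have MN : map_mx (horner_eval 0) M = N.
  by apply/matrixP => i j; rewrite !mxE /horner_eval horner_coef0 M0.
split=> [k kn|].
  rewrite -horner_coef0 -[LHS]/(horner_eval 0 _) -coef_map map_char_poly MN.
  rewrite char_poly_trig => [|].
    rewrite (eq_bigr (fun=> 'X)) => [|i _].
      by rewrite prodr_const card_ord coefXn ltn_eqF.
    by rewrite mxE gtn_eqF // subr0.
  by apply/is_trig_mxP => i j ij; rewrite mxE gtn_eqF // ltnS ltnW.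
have cofN j : (cofactor M 0 j)`_0 = cofactor N 0 j.
  by rewrite -horner_coef0 -[LHS]/(horner_eval 0 _) -cofactor_map_mx MN.
(* Deleting another column keeps the last column of [N], which is zero. *)
have cof0 j : j != ord_max -> cofactor N 0 j = 0.
  move=> jm; rewrite /cofactor.
  have [l l_max _] := unlift_some jm.
  rewrite (expand_det_col _ l) big1 ?mulr0 // => k _.
  by rewrite !mxE -l_max /= gtn_eqF ?mul0r // ltnS ltn_ord.
have cof1 : cofactor N 0 ord_max = (-1) ^+ n.
  rewrite /cofactor add0n (_ : row' _ _ = 1%:M) ?det1 ?mulr1 //.
  by apply/matrixP => i j; rewrite !mxE lift_max /= eqSS eq_sym.
have detM : (\det M)`_1 = (M 0 ord_max)`_1 * (-1) ^+ n.
  rewrite (expand_det_row _ 0) coef_sum (bigD1 ord_max) //= big1 => [|j jm].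
    rewrite coefM !big_ord_recl big_ord0 /= M0 mul0r add0r !addr0 subnn.
    by rewrite cofN cof1.
  rewrite coefM !big_ord_recl big_ord0 /= M0 mul0r add0r !addr0 subnn.
  by rewrite cofN cof0 // mulr0.
rewrite char_poly_det -signr_odd; case: odd; rewrite ?expr1 ?expr0 ?mulN1r ?mul1r.
  by rewrite coefN detM oppr_eq0 mulf_neq0 // signr_eq0.
by rewrite detM mulf_neq0 // signr_eq0.
Qed.

Lemma common_root_resultant (R : comNzRingType) (p q : {poly R}) (x : R) :
  (1 < size p)%N -> (1 < size q)%N -> root p x -> root q x -> resultant p q = 0.
Proof.
move=> sp sq /rootP px /rootP qx; have [[u v] /= _ e] := resultant_in_ideal sp sq.
have px' : (u * p).[x] = 0 by rewrite hornerM_comm ?px ?mulr0 //; exact: mulrC.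
have qx' : (v * q).[x] = 0 by rewrite hornerM_comm ?qx ?mulr0 //; exact: mulrC.
by have := congr1 (horner^~ x) e; rewrite hornerC hornerD px' qx' addr0.
Qed.

Lemma poly_eq0_shifted_nat (R : numDomainType) (p : {poly R}) (a : R) :
  (forall k : nat, p.[k%:R - a] = 0) -> p = 0.
Proof.
move=> p0; apply: (@roots_geq_poly_eq0 _ _ [seq k%:R - a | k <- iota 0 (size p)]).
- by apply/allP => _ /mapP [k _ ->]; apply/rootP.
- rewrite map_inj_uniq ?iota_uniq // => k l /addIr /eqP.
  by rewrite eqr_nat => /eqP.
- by rewrite size_map size_iota.
Qed.

(** Monicity makes the resultant commute with specialization, so it vanishes at all k - a, hence
    identically. The shift [a] will be i, the parameter being t - i. *)
Lemma eisenstein_common_roots_eq (C : numClosedFieldType) (n : nat) (a : C)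
    (p q : {poly {poly C}}) :
  (0 < n)%N -> p \is monic -> size p = n.+1 ->
  (forall j, (j < n)%N -> p`_j`_0 = 0) -> p`_0`_1 != 0 ->
  q \is monic -> size q = n.+1 ->
  (forall k : nat, exists x, root (map_poly (horner_eval (k%:R - a)) p) x /\
                             root (map_poly (horner_eval (k%:R - a)) q) x) ->
  p = q.
Proof.
move=> n0 pm sp pj p01 qm sq common; apply: (eisenstein_resultant_eq n0) => //.
have lc (r : {poly {poly C}}) (s : C) : r \is monic -> horner_eval s (lead_coef r) != 0.
  by move=> rm; rewrite (monicP rm) /horner_eval hornerC oner_neq0.
apply: (@poly_eq0_shifted_nat _ _ a) => k; have [x [px qx]] := common k.
rewrite -[LHS]/(horner_eval _ _) map_resultant ?lc //.
by apply: common_root_resultant px qx; rewrite size_map_poly_id0 ?lc // ?sp ?sq ltnS.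
Qed.

(** The Eisenstein conditions bear on [X] alone: [Y] will be the image curve, of which only the
    shared eigenvalues at real parameters are known. *)
Lemma gram_curve_char_poly (C : numClosedFieldType) (n m : nat)
    (X Y : nat -> 'M[C]_n.+1) (t : C) :
  (forall s : C, s \is Num.real ->
     exists x,
       root (char_poly (adjmx (\sum_(k < m) s ^+ k *: X k)
                        *m (\sum_(k < m) s ^+ k *: X k))) x /\
       root (char_poly (adjmx (\sum_(k < m) s ^+ k *: Y k)
                        *m (\sum_(k < m) s ^+ k *: Y k))) x) ->
  (forall i j, (gram_curve m X i j)`_0 = (j.+1 == i)%N%:R) ->
  (gram_curve m X 0 ord_max)`_1 != 0 -> t \is Num.real ->
  char_poly (adjmx (\sum_(k < m) t ^+ k *: X k) *m (\sum_(k < m) t ^+ k *: X k)) =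
  char_poly (adjmx (\sum_(k < m) t ^+ k *: Y k) *m (\sum_(k < m) t ^+ k *: Y k)).
Proof.
move=> common X0 X1 tR; have [] := eisenstein_char_poly X0 X1.
pose G (Z : nat -> 'M[C]_n.+1) (s : C) : 'M[C]_n.+1 :=
  adjmx (\sum_(k < m) s ^+ k *: Z k) *m (\sum_(k < m) s ^+ k *: Z k).
have evalr (Z : nat -> 'M[C]_n.+1) (s : C) : s \is Num.real ->
    map_poly (horner_eval (s - 'i)) (char_poly (gram_curve m Z)) =
    char_poly (G Z s + (-1)%:M).
  by move=> sR; rewrite map_char_poly gram_curve_eval (CrealP sR).
have := evalr Y; have := evalr X.
have := size_char_poly (gram_curve m Y); have := size_char_poly (gram_curve m X).
have := char_poly_monic (gram_curve m Y); have := char_poly_monic (gram_curve m X).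
move: (char_poly (gram_curve m X)) (char_poly (gram_curve m Y)) => p q.
move=> pm qm sp sq evp evq P0 P1.
have pq : p = q.
  apply: (@eisenstein_common_roots_eq _ n.+1 'i) => // k.
  have kR : k%:R \is @Num.real C := realn _ _.
  have [x [rX rY]] := common _ kR; exists (x + -1).
  by rewrite (evp _ kR) (evq _ kR); split; apply: root_char_poly_addC.
by apply: (@char_poly_addC_inj _ _ _ _ (-1)); rewrite -(evp _ tR) -(evq _ tR) pq.
Qed.

(** * The cubic Toeplitz curve *)

(* The curve (1 + t^2) (A + c t S^(n+1)) + (i t/2) S - t^2 (1 + S/2), which is
   A at t = 0, 1 at t = i and 1 + S at t = -i; [c] is chosen so that the corner
   entry of its derivative at t = i is 1. *)
Definition toeplitz_curve (C : numClosedFieldType) (n : nat) (A : 'M[C]_n.+2) (k : nat)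
    : 'M[C]_n.+2 :=
  let S := Sjordan C n.+1 in
  let c := 'i * A 0 ord_max - 'i / 4 * S 0 ord_max - 1 / 2 in
  match k with
  | 0 => A
  | 1 => c *: S ^+ n.+1 + ('i / 2) *: S
  | 2 => A - 1 - 2^-1 *: S
  | 3 => c *: S ^+ n.+1
  | _ => 0
  end.

Lemma in_toeplitz_curve (C : numClosedFieldType) (n : nat) (A : 'M[C]_n.+2) k :
  in_toeplitz A -> in_toeplitz (toeplitz_curve A k).
Proof.
move=> TA; have T1 : in_toeplitz (1 : 'M[C]_n.+2)
  by rewrite -[1](expr0 (Sjordan C n.+1)); exact: in_toeplitzXn.
have TS : in_toeplitz (Sjordan C n.+1)
  by rewrite -[Sjordan C n.+1]expr1; exact: in_toeplitzXn.
have T0 := in_toeplitz0 C n.+1.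
case: k => [|[|[|[|k]]]] //=.
- apply: in_toeplitzZD; first exact: in_toeplitzXn.
  by rewrite -[_ *: _]addr0; apply: in_toeplitzZD.
- rewrite addrC -scaleNr; apply: in_toeplitzZD => //.
  by rewrite addrC -scaleN1r; apply: in_toeplitzZD.
- by rewrite -[_ *: _]addr0; apply: in_toeplitzZD => //; exact: in_toeplitzXn.
Qed.

Lemma imaginary_half (C : numClosedFieldType) : 'i * ('i / 2) = - 2^-1 :> C.
Proof. by rewrite mulrA -expr2 sqrCi mulN1r. Qed.

Lemma imaginary_cube (C : numClosedFieldType) : 'i ^+ 3 = - 'i :> C.
Proof. by rewrite exprS sqrCi mulrN1. Qed.

(** At t = i and t = -i the factor 1 + t^2 removes the terms in A and c. There remains (i t/2) S + 1
    + S/2, whose multiples of S cancel at i and add up to S at -i. *)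
Lemma toeplitz_curve_i (C : numClosedFieldType) (n : nat) (A : 'M[C]_n.+2) :
  \sum_(k < 4) 'i ^+ k *: toeplitz_curve A k = 1.
Proof.
rewrite !big_ord_recl big_ord0 /=; set c := _ - 1 / 2; set Z := Sjordan C n.+1 ^+ _.
rewrite expr0 expr1 sqrCi imaginary_cube scalerDr !scalerA imaginary_half.
by apply/matrixP => i j; rewrite !mxE; ring.
Qed.

Lemma toeplitz_curve_Ni (C : numClosedFieldType) (n : nat) (A : 'M[C]_n.+2) :
  \sum_(k < 4) (- 'i) ^+ k *: toeplitz_curve A k = 1 + Sjordan C n.+1.
Proof.
rewrite !big_ord_recl big_ord0 /=; set c := _ - 1 / 2; set Z := Sjordan C n.+1 ^+ _.
rewrite expr0 expr1 sqrrN exprNn imaginary_cube sqrCi scalerDr !scalerA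
  ![- 'i * _]mulNr imaginary_half.
by apply/matrixP => i j; rewrite !mxE; field.
Qed.

Lemma toeplitz_curve_0 (C : numClosedFieldType) (n : nat) (A : 'M[C]_n.+2) :
  \sum_(k < 4) 0 ^+ k *: toeplitz_curve A k = A.
Proof.
by rewrite !big_ord_recl big_ord0 expr0 scale1r !expr0n /= !scale0r !addr0.
Qed.

Lemma toeplitz_curve_deriv (C : numClosedFieldType) (n : nat) (A : 'M[C]_n.+2) :
  (mxcurve 4 (toeplitz_curve A) 0 ord_max)`_1 = 1.
Proof.
transitivity ((mxcurve 4 (toeplitz_curve A) 0 ord_max)^`()).[0].
  by rewrite horner_coef0 coef_deriv.
rewrite mxE !big_ord_recl big_ord0 /= !mxE SjordanE add0n eqxx.
have i2 : 'i * 'i = -1 :> C by rewrite -expr2 sqrCi.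
have i2' : 'i * ('i + 'i) = -1 - 1 :> C by rewrite mulrDr i2.
rewrite !derivE !hornerE /= i2 i2'.
(* [s] is the corner entry of S, which is 1 in size 2 and 0 in larger sizes; the choice of c
   accounts for both. *)
set f : C := A _ _; set s : C := (1%N == _)%:R; set u : C := 'i.
by field.
Qed.

Lemma gram_toeplitz_curve_0 (C : numClosedFieldType) (n : nat) (A : 'M[C]_n.+2) i j :
  (gram_curve 4 (toeplitz_curve A) i j)`_0 = (j.+1 == i)%N%:R.
Proof.
transitivity (map_mx (horner_eval ('i - 'i)) (gram_curve 4 (toeplitz_curve A)) i j).
  by rewrite [RHS]mxE subrr /horner_eval horner_coef0.
rewrite gram_curve_eval conjCi toeplitz_curve_i toeplitz_curve_Ni mulmx1 !mxE.
by rewrite rmorphD !rmorph_nat eq_sym mulNrn addrAC subrr add0r.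
Qed.

Lemma mxcurve_coef0 (C : numClosedFieldType) (n m : nat) (X : nat -> 'M[C]_n.+1) i j :
  (mxcurve m X i j)`_0 = (\sum_(k < m) 'i ^+ k *: X k) i j.
Proof. by rewrite -mxcurve_eval [RHS]mxE subrr /horner_eval horner_coef0. Qed.

(** The coefficients being upper triangular, row 0 of the continued adjoint is zero off the
    diagonal, so the corner is a product of two polynomials. In the product rule at t = i, the
    corner of A(i) = 1 is 0 and the first entry of (1 + S)^* is 1, which leaves the corner of
    A'(i). *)
Lemma gram_toeplitz_curve_1 (C : numClosedFieldType) (n : nat) (A : 'M[C]_n.+2) :
  in_toeplitz A ->
  (gram_curve 4 (toeplitz_curve A) 0 ord_max)`_1 != 0.
Proof.
move=> TA; rewrite mxE [X in _ + X]mxE mulr0n addr0 mxE (bigD1 0) //= big1 => [|k k0].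
  rewrite addr0 coefM !big_ord_recl big_ord0 /= addr0 subnn toeplitz_curve_deriv.
  have -> : (mxcurve 4 (toeplitz_curve A) 0 ord_max)`_0 = 0.
    by rewrite mxcurve_coef0 toeplitz_curve_i mxE.
  rewrite mulr0 addr0 mulr1 mxcurve_coef0.
  have := adjmx_sum 4 (toeplitz_curve A) (- 'i).
  rewrite rmorphN /= conjCi opprK => ->; rewrite toeplitz_curve_Ni !mxE.
  by rewrite rmorphD !rmorph_nat addr0 oner_neq0.
rewrite [mxcurve _ _ _ _]mxE big1 ?mul0r // => l _.
by rewrite mxE mxE (toeplitz_col0 (in_toeplitz_curve l TA) k0) rmorph0 scale0r.
Qed.

(** * Dimension one and the conclusion *)

Lemma char_poly_mx11 (R : comNzRingType) (M : 'M[R]_1) :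
  char_poly M = 'X - (M 0 0)%:P.
Proof. by rewrite /char_poly det_mx11 !mxE. Qed.

Theorem theorem3p1 (C : numClosedFieldType) (n : nat) (phi : 'M[C]_n.+1 -> 'M[C]_n.+1) :
  linear_on_toeplitz phi -> isometry_on_toeplitz phi ->
  forall A : 'M[C]_n.+1, in_toeplitz A ->
    char_poly (adjmx A *m A) = char_poly (adjmx (phi A) *m phi A).
Proof.
case: n phi => [|n] phi lin iso A TA.
  (* In dimension one there is no off-diagonal corner, but a monic linear polynomial is determined
     by its root. *)
  have [x [rA rphi]] := same_opnorm_common_root (iso A TA).
  move: rA rphi; rewrite !char_poly_mx11 !root_XsubC => /eqP <- /eqP <-.
  by [].
have TX k := in_toeplitz_curve k TA.
have phi_sum (t : C) := linear_on_toeplitz_sum 4 (fun k => t ^+ k) lin TX.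
(* By linearity the image of the curve is the curve of the images; at t = 0 the two pass through [A]
   and [phi A]. *)
have := @gram_curve_char_poly _ _ 4 (toeplitz_curve A) (phi \o toeplitz_curve A) 0.
rewrite /= -(phi_sum 0).2 toeplitz_curve_0; apply=> //.
- move=> s _; rewrite -(phi_sum s).2; apply: same_opnorm_common_root.
  by apply: iso; exact: (phi_sum s).1.
- exact: gram_toeplitz_curve_0.
- exact: gram_toeplitz_curve_1.
Qed.
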